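(* Let $\rho>0$, let $L\ge1$ and $D\ge 2$ be integers, $\sigma_E^2=\frac{1}{1+\rho L}$, $G=\frac{1}{\rho(1-\sigma_E^2)}$, and $y>0$. Suppose a single access point transmits to $D$ devices at nominal SNR $\rho$: let $\hat h_1,\dots,\hat h_D$ be independent $\mathcal{CN}(0,1-\sigma_E^2)$ random variables and $Y_d=\frac{1}{\log_2(1+\rho|\hat h_d|^2)}$ for $d=1,\dots,D$. Then the probability of time underflow with respect to the deadline $y$ satisfies $$\exp\left(-DG\left(2^{D/y}-1\right)\right)\le\mathbb{P}\left[\sum_{d=1}^D Y_d\le y\right]\le\exp\left(-DG\left(2^{1/y}-1\right)\right).$$
   Context: $\mathcal{CN}(0,s)$ denotes the circularly symmetric complex Gaussian distribution with mean $0$ and variance $s$ (so $X\sim\mathcal{CN}(0,s)$ has $\mathbb{E}|X|^2=s$). $\hat h_d$ is the MMSE channel estimate for device $d$ from $L$ pilots. With bandwidth $W$, the rate selected for device $d$ is $R_d=W\log_2(1+\rho|\hat h_d|^2)$, and $Y_d=W/R_d$ is the time needed to transmit one bit in one Hertz. $G$ is the measurement noise-to-signal ratio. *)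

(* Defs.v *)
From HB Require Import structures.
From mathcomp Require Import all_boot all_order all_algebra.
From mathcomp Require Import complex.
From mathcomp Require Import all_classical all_reals all_analysis.
Set Implicit Arguments.
Unset Strict Implicit.
Unset Printing Implicit Defensive.
Import Order.TTheory GRing.Theory Num.Theory.
Import numFieldNormedType.Exports.
Local Open Scope classical_set_scope.
Local Open Scope ring_scope.

Definition complex_to_pair (R : realType) (z : R[i]) : R * R :=
  (complex.Re z, complex.Im z).

(* Borel sigma-algebra of C, transported from R * R *)
HB.instance Definition _ (R : realType) := isPointed.Build R[i] 0.
HB.instance Definition _ (R : realType) :=
  Measurable.copy R[i] (g_sigma_algebra_preimageType (@complex_to_pair R)).

(* CN(0, s) for s > 0: the real and imaginary parts are independent and
   N(0, s / 2); the second argument of normal_prob is a standard deviation. *)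
Definition complex_normal (R : realType) (s : R) : set R[i] -> \bar R :=
  pushforward
    (normal_prob 0 (Num.sqrt (s / 2)) \x normal_prob 0 (Num.sqrt (s / 2)))%E
    (fun p : R * R => Complex p.1 p.2).

Definition mutually_independent (R : realType) (d d' : measure_display)
    (T : measurableType d) (T' : measurableType d') (P : probability T R)
    (I : finType) (X : I -> {RV P >-> T'}) : Prop :=
  forall (J : {set I}) (A : I -> set T'),
    (forall i, i \in J -> measurable (A i)) ->
    P (\bigcap_(i in [set` J]) (X i @^-1` A i))
      = (\prod_(i in J) P (X i @^-1` A i))%E.

Definition log2 (R : realType) (x : R) : R := ln x / ln 2.

Definition error_variance (R : realType) (rho : R) (L : nat) : R :=
  1 / (1 + rho * L%:R).

Definition noise_to_signal (R : realType) (rho : R) (L : nat) : R :=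
  1 / (rho * (1 - error_variance rho L)).

(* Time to transmit one bit in one Hertz at channel estimate z; it is
   extended-real valued, and equal to +oo when z = 0. *)
Definition bit_time (R : realType) (rho : R) (z : R[i]) : \bar R :=
  (1 / (log2 (1 + rho * Normc.normc z ^+ 2))%:E)%E.

(* Main.v *)
Require Import Defs.
From mathcomp Require Import all_boot all_order all_algebra.
From mathcomp Require Import complex.
From mathcomp Require Import all_classical all_reals all_analysis.
From mathcomp Require Import measurable_realfun ring.
Set Implicit Arguments.
Unset Strict Implicit.
Unset Printing Implicit Defensive.
Import Order.TTheory GRing.Theory Num.Theory.
Import numFieldNormedType.Exports.
Local Open Scope classical_set_scope.
Local Open Scope ring_scope.

(* The sum of the D nonnegative times is at most y if each of them is at most
   y / D, and only if each of them is at most y. By independence both bounding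
   events have as probability the D-th power of P(Y <= a) for a = y / D and
   a = y. Since Y <= a means |h|^2 >= (2^(1/a) - 1) / rho, and |h|^2 is
   exponentially distributed with mean s = 1 - sigma_E^2 when h is CN(0, s),
   this probability is exp(- G (2^(1/a) - 1)).

   The exponential tail of |h|^2 is obtained without polar coordinates: by the
   substitution y = |x| u, Tonelli's theorem and x = w / sqrt(1 + u^2), the
   integral over the plane of f(x^2 + y^2) is C times the integral of
   |w| f(w^2), with C the integral of 1 / (1 + u^2). For the Gaussian density
   cut off below r this gives c exp(- r / s), and c = 1 by taking r = 0. *)

(** * Changes of variables for nonnegative integrands *)

(** Lebesgue measure is [c] times its own pushforward under multiplication by [c]: the two measures
    agree on half-open intervals, which determine them. This covers integrands with jumps, such as
    the cut-off Gaussian. *)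
Lemma ge0_integral_scale (R : realType) (c : R) (f : R -> \bar R) :
  0 < c -> measurable_fun [set: R] f -> (forall x, 0 <= f x)%E ->
  (\int[lebesgue_measure]_x f x =
   c%:E * \int[lebesgue_measure]_x f (c * x)%R)%E.
Proof.
move=> c0 mf f0.
have mc : measurable_fun setT ( *%R c : measurableTypeR R -> measurableTypeR R).
  exact: mulrl_measurable.
pose C := NngNum (ltW c0).
(* The pushforward is a measure only given a measurability proof, which becomes
   an argument of nu0. *)
pose nu0 : {measure set (measurableTypeR R) -> \bar R} :=
  mscale C (pushforward lebesgue_measure
    ( *%R c : measurableTypeR R -> measurableTypeR R)).
pose nu := nu0 mc.
have E (A : set R) : measurable A -> lebesgue_measure A = nu A.
  move=> mA; apply: lebesgue_measure_unique => // _ [[a b]] _ <-.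
  rewrite /nu /nu0/= /mscale /pushforward/=.
  transitivity (c%:E * lebesgue_measure `](a / c)%R, (b / c)%R])%E; last first.
    congr (_ * lebesgue_measure _)%E; apply/seteqP; split => x/=; rewrite !in_itv/=.
      by rewrite ltr_pdivrMr// ler_pdivlMr// mulrC.
    by rewrite ltr_pdivrMr// ler_pdivlMr// mulrC.
  rewrite !lebesgue_measure_itv/= !lte_fin ltr_pM2r ?invr_gt0//.
  case: ifPn => _; last by rewrite mule0.
  by rewrite -!EFinD -EFinM -mulrBl mulrC divfK ?gt_eqF.
transitivity (\int[nu]_x f x)%E.
  by apply: eq_measure_integral => A mA _; apply: E.
rewrite /nu /nu0 ge0_integral_mscale//; congr (_ * _)%E.
by rewrite ge0_integral_pushforward.
Qed.

Lemma ge0_integral_radial (R : realType) (f : R -> \bar R) :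
  measurable_fun [set: R] f -> (forall x, 0 <= f x)%E ->
  (\int[lebesgue_measure]_x \int[lebesgue_measure]_y f (x ^+ 2 + y ^+ 2)%R =
   (\int[lebesgue_measure]_u ((1 + u ^+ 2)^-1)%:E) *
   \int[lebesgue_measure]_w (`|w|%:E * f (w ^+ 2)%R))%E.
Proof.
move=> mf f0.
pose g (p : R * R) := (`|p.1|%:E * f (p.1 ^+ 2 * (1 + p.2 ^+ 2))%R)%E.
have g0 p : (0 <= g p)%E by rewrite mule_ge0.
have mg : measurable_fun [set: R * R] g.
  apply: emeasurable_funM.
    by apply/measurable_EFinP; apply: measurableT_comp => //; exact: measurable_fst.
  apply: measurableT_comp => //=.
  apply: measurable_funM; first exact: measurable_funX.
  by apply: measurable_funD => //; exact: measurable_funX.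
have mh : measurable_fun [set: R * R] (fun p => f (p.1 ^+ 2 + p.2 ^+ 2)).
  apply: measurableT_comp => //=.
  by apply: measurable_funD; exact: measurable_funX.
transitivity (\int[lebesgue_measure]_x \int[lebesgue_measure]_u g (x, u))%E.
  apply: ae_eq_integral => //.
  - exact: (measurable_fun_fubini_tonelli_F (m2 := lebesgue_measure) _ mh).
  - exact: (measurable_fun_fubini_tonelli_F (m2 := lebesgue_measure) _ mg).
  (* The substitution y = |x| u degenerates at x = 0 only. *)
  exists [set 0]; split => //; first exact: lebesgue_measure_set1.
  move=> x /=; apply: contra_notP => x0 _.
  have ax0 : 0 < `|x| by rewrite normr_gt0; exact/eqP.
  have mx : measurable_fun [set: R] (fun y => f (x ^+ 2 + y ^+ 2)).
    by apply: (measurableT_comp mf); apply: measurable_funD.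
  rewrite (ge0_integral_scale ax0)// -ge0_integralZl//; last first.
    by apply: (measurableT_comp mx); exact: mulrl_measurable.
  apply: eq_integral => u _; rewrite /g/= exprMn real_normK ?num_real//.
  by rewrite mulrDr mulr1.
rewrite (fubini_tonelli (m1 := lebesgue_measure) (m2 := lebesgue_measure) _ mg)//.
rewrite -ge0_integralZr//; last 3 first.
- apply/measurable_EFinP; apply: continuous_measurable_fun.
  exact: continuous_oneDsqrV.
- by move=> u _; rewrite lee_fin invr_ge0 addr_ge0// sqr_ge0.
- by apply: integral_ge0 => w _; rewrite mule_ge0.
apply: eq_integral => u _.
have v0 : 0 < 1 + u ^+ 2 by rewrite ltr_wpDr// sqr_ge0.
have c0 : 0 < Num.sqrt (1 + u ^+ 2) by rewrite sqrtr_gt0.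
have mk : measurable_fun [set: R] (fun w => `|w|%:E * f (w ^+ 2)%R)%E.
  apply: emeasurable_funM; first by apply/measurable_EFinP.
  by apply: (measurableT_comp mf); exact: measurable_funX.
(* With w = sqrt(1 + u^2) x the root appears twice, once from dw and once from |w|; together they
   cancel (1 + u^2)^-1 and leave |x|. *)
rewrite (ge0_integral_scale c0)//; last by move=> w; rewrite mule_ge0.
rewrite muleA -EFinM.
rewrite -ge0_integralZl//; last 3 first.
- apply: (measurableT_comp mk); exact: mulrl_measurable.
- by move=> w _; rewrite mule_ge0.
- by rewrite lee_fin mulr_ge0 ?invr_ge0 ?ltW.
apply: eq_integral => x _; rewrite /g/= muleA -EFinM; congr (_%:E * f _)%E.
  rewrite normrM (gtr0_norm c0) mulrA -[_ * _ * Num.sqrt _]mulrA -expr2.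
  by rewrite sqr_sqrtr ?ltW// mulVf ?mul1r ?gt_eqF.
by rewrite exprMn sqr_sqrtr ?ltW// mulrC.
Qed.

Lemma ge0_integral_even (R : realType) (f : R -> \bar R) :
  measurable_fun [set: R] f -> (forall x, 0 <= f x)%E -> f =1 f \o -%R ->
  (\int[lebesgue_measure]_x f x =
   2%:E * \int[lebesgue_measure]_(x in `[0%R, +oo[) f x)%E.
Proof.
move=> mf f0 fN.
rewrite -(setUv `[0%R, +oo[%classic) ge0_integral_setU//=; last 3 first.
- exact: measurableC.
- by rewrite setUv.
- exact/disj_setPCl.
rewrite mule_natl mule2n; congr (_ + _)%E.
rewrite ge0_integration_by_substitution0// setCitvr.
(* The complement of [[0, +oo[] is open at 0 while the reflected half-line is closed there; one
   point does not change the integral. *)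
rewrite (@integral_itv_bndo_bndc _ -oo%O 0 f)//; last exact: measurable_funTS.
by apply: eq_integral => x _; rewrite [LHS]fN.
Qed.

(** * The one-dimensional radial integral *)

Lemma integral_itv_Mexp_sqr (R : realType) (s a : R) : 0 < s -> 0 <= a ->
  (\int[lebesgue_measure]_(x in `[a, +oo[) (x * expR (- (x ^+ 2 / s)))%:E =
   (s / 2 * expR (- (a ^+ 2 / s)))%:E)%E.
Proof.
move=> s0 a0.
(* An antiderivative of the integrand that tends to 0 at infinity, so the integral is - F a. *)
pose F x : R := - (s / 2 * expR (- (x ^+ 2 / s))).
have dF (x : R) : is_derive x 1 F (x * expR (- (x ^+ 2 / s))).
  rewrite /F; apply: is_derive_eq.
  by rewrite /GRing.scale/=; field; rewrite gt_eqF.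
have cF : continuous F.
  move=> x; apply: differentiable_continuous; apply/derivable1_diffP.
  exact: ex_derive.
rewrite (@ge0_continuous_FTC2y _ _ F _ 0)//.
- by rewrite /F -EFinB sub0r opprK.
- by move=> x ax; rewrite mulr_ge0 ?expR_ge0// (le_trans a0).
- apply: continuous_subspaceT => x.
  by apply: differentiable_continuous; apply/derivable1_diffP; exact: ex_derive.
- rewrite /F -oppr0; apply: cvgN; rewrite -(mulr0 (s / 2)); apply: cvgMr.
  rewrite (_ : (fun x => expR (- (x ^+ 2 / s))) =
               (fun z => expR (- z)) \o (fun z => z / s) \o (fun x => x ^+ 2))//.
  apply: (@cvg_comp _ _ _ _ _ _ (pinfty_nbhs R)); last first.
    apply: (@cvg_comp _ _ _ _ _ _ (pinfty_nbhs R)); last exact: cvgr_expR.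
    by apply: gt0_cvgMly => //; rewrite invr_gt0.
  exact: cvgr_expr2.
- by apply: cvg_at_right_filter; exact: cF.
- by move=> x _; rewrite derive1E; exact: derive_val.
Qed.

(** By evenness this is twice the integral over w >= 0, where the cutoff r <= w^2 reads sqrt r <= w;
    the factor 2 absorbs the half in s / 2. *)
Lemma integral_normM_exp_tail (R : realType) (s r : R) : 0 < s -> 0 <= r ->
  (\int[lebesgue_measure]_w
     (`|w|%:E * (\1_`[r, +oo[ (w ^+ 2) * expR (- (w ^+ 2 / s)))%:E) =
   (s * expR (- (r / s)))%:E)%E.
Proof.
move=> s0 r0.
rewrite ge0_integral_even; last 3 first.
- apply: emeasurable_funM; first exact/measurable_EFinP.
  apply/measurable_EFinP; apply: measurable_funM.
    apply: (@measurableT_comp _ _ _ _ _ _ (\1_`[r, +oo[ : R -> R)) => //.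
  by do 2 (apply: measurableT_comp => //); apply: measurable_funM.
- by move=> w; rewrite mule_ge0// lee_fin mulr_ge0 ?expR_ge0.
- by move=> w /=; rewrite normrN sqrrN.
transitivity (2%:E * \int[lebesgue_measure]_(x in `[Num.sqrt r, +oo[)
    (x * expR (- (x ^+ 2 / s)))%:E)%E.
  congr (_ * _)%E; rewrite integral_mkcond [RHS]integral_mkcond.
  apply: eq_integral => w _; rewrite !patchE !mem_setE !in_itv/= !andbT.
  rewrite indicE mem_setE in_itv/= andbT.
  have [w0|w0] := leP 0 w; last first.
    by rewrite ifF// lt_geF// (lt_le_trans w0)// sqrtr_ge0.
  have -> : (Num.sqrt r <= w) = (r <= w ^+ 2).
    by rewrite -{1}(ger0_norm w0) -sqrtr_sqr ler_sqrt ?sqr_ge0.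
  by case: ifPn => _; rewrite ?mul0r ?mule0// mul1r ger0_norm// EFinM.
rewrite integral_itv_Mexp_sqr ?sqrtr_ge0// sqr_sqrtr// -EFinM; congr EFin.
by rewrite mulrA mulrCA divff ?mulr1.
Qed.

(** * Tail of the squared modulus of a complex Gaussian *)

(** The Radon-Nikodym derivative is an abstract choice; it equals [normal_pdf] almost everywhere
    because both have the same integral over every measurable set. *)
Lemma integral_normal_prob (R : realType) (m sigma : R) (f : R -> \bar R) :
  sigma != 0 -> (normal_prob m sigma).-integrable [set: R] f ->
  (\int[normal_prob m sigma]_x f x =
   \int[lebesgue_measure]_x (f x * (normal_pdf m sigma x)%:E))%E.
Proof.
move=> s0 intf.
have mf : measurable_fun [set: R] f := measurable_int _ intf.
rewrite -(Radon_Nikodym_change_of_variables (normal_prob_dominates m sigma))//.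
apply: ae_eq_integral => //.
- apply: emeasurable_funM => //; apply: (measurable_int lebesgue_measure).
  by apply: Radon_Nikodym_integrable; exact: normal_prob_dominates.
- apply: emeasurable_funM => //; apply/measurable_EFinP.
  exact: measurable_normal_pdf.
- apply: ae_eqe_mul2l => /=.
  rewrite Radon_NikodymE//=; first exact: normal_prob_dominates.
  move=> dom; case: cid => /= g [g1 g2 g3].
  apply: integral_ae_eq => //=.
    apply/measurable_EFinP; exact: measurable_normal_pdf.
  by move=> E _ mE; rewrite -g3.
Qed.

Lemma complex_normal_tail (R : realType) (s r : R) : 0 < s -> 0 <= r ->
  complex_normal s [set z | r <= Normc.normc z ^+ 2] = (expR (- (r / s)))%:E.
Proof.
move=> s0.
pose sigma := Num.sqrt (s / 2).
have sigma0 : sigma != 0 by rewrite gt_eqF// sqrtr_gt0 divr_gt0.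
(* The exponent of the normal density has denominator 2 sigma^2. *)
have sigma2 : sigma ^+ 2 *+ 2 = s.
  by rewrite sqr_sqrtr ?divr_ge0 ?ltW// -mulr_natr divfK.
pose N := normal_prob 0 sigma.
pose B u : set (R * R) := [set p | u <= p.1 ^+ 2 + p.2 ^+ 2].
have mB u : measurable (B u).
  rewrite (_ : B u = (fun p => p.1 ^+ 2 + p.2 ^+ 2) @^-1` `[u, +oo[); last first.
    by apply/seteqP; split => p; rewrite /B/= in_itv/= andbT.
  rewrite -[X in measurable X]setTI.
  suff : measurable_fun [set: R * R] (fun p => p.1 ^+ 2 + p.2 ^+ 2) by exact.
  by apply: measurable_funD; apply: measurable_funX.
have BE u : complex_normal s [set z | u <= Normc.normc z ^+ 2] = (N \x N)%E (B u).
  rewrite /complex_normal /pushforward/=; congr (_ _).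
  apply/seteqP; split => -[x y]/=; rewrite /B/= sqr_sqrtr//.
    by rewrite addr_ge0// sqr_ge0.
  by rewrite addr_ge0// sqr_ge0.
set C := (\int[@lebesgue_measure R]_u ((1 + u ^+ 2)^-1)%:E)%E.
(* Stated for every threshold, so that the constant in front can be read off at [u] = 0. *)
have T u : 0 <= u -> ((N \x N)%E (B u) =
    C * (normal_peak sigma ^+ 2 * s)%:E * (expR (- (u / s)))%:E)%E.
  move=> u0.
  transitivity (\int[N]_x N (xsection (B u) x))%E => //.
  rewrite /N integral_normal_prob//; last first.
    (* The sections have mass at most 1, hence are dominated by the constant 1. *)
    apply: (@le_integrable _ _ _ N _ measurableT _ (cst 1%E)).
    - exact: (measurable_fun_xsection N (mB u)).
    - move=> x _; rewrite !gee0_abs//; apply: probability_le1.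
      exact: (measurable_xsection x (mB u)).
    - exact: finite_measure_integrable_cst.
  (* The joint density of the two coordinates, cut off below [u], as a function of t = x^2 + y^2. *)
  pose phi (t : R) := ((normal_peak sigma ^+ 2)%:E *
    (\1_`[u, +oo[ t * expR (- (t / s)))%:E)%E.
  have mpsi : measurable_fun [set: R]
      (fun t : R => (\1_`[u, +oo[ t * expR (- (t / s)))%:E).
    apply/measurable_EFinP; apply: measurable_funM; first exact: measurable_indic.
    by do 2 (apply: measurableT_comp => //); apply: measurable_funM.
  transitivity (\int[lebesgue_measure]_x \int[lebesgue_measure]_y
      phi (x ^+ 2 + y ^+ 2)%R)%E.
    apply: eq_integral => x _.
    rewrite /normal_prob integral_mkcond -ge0_integralZr//; last 3 first.
    - apply/(measurable_restrictT _ _).1; first exact: (measurable_xsection x (mB u)).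
      by apply: measurable_funTS; apply/measurable_EFinP; exact: measurable_normal_pdf.
    - by move=> y _; rewrite patchE; case: ifPn => // _; rewrite lee_fin normal_pdf_ge0.
    - by rewrite lee_fin normal_pdf_ge0.
    apply: eq_integral => y _; rewrite patchE mem_xsection /phi indicE.
    have -> : ((x, y) \in B u) = (u <= x ^+ 2 + y ^+ 2).
      by apply/idP/idP; rewrite inE.
    rewrite !mem_setE in_itv/= andbT normal_pdfE//.
    case: ifPn => _; last by rewrite !(mul0e, mul0r, mule0).
    rewrite mul1r -!EFinM /normal_fun !subr0 sigma2; congr EFin.
    rewrite mulrACA -expRD -expr2; congr (_ * expR _).
    by rewrite !mulNr -opprD -mulrDl addrC.
  rewrite ge0_integral_radial; last 2 first.
  - exact: measurable_funeM.
  - by move=> t; rewrite mule_ge0// lee_fin ?sqr_ge0// mulr_ge0 ?expR_ge0.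
  rewrite -/C -muleA; congr (_ * _)%E.
  under eq_integral do rewrite /phi muleCA.
  rewrite ge0_integralZl//; last 2 first.
  - apply: emeasurable_funM; first exact/measurable_EFinP.
    by apply: (measurableT_comp mpsi); exact: measurable_funX.
  - by rewrite lee_fin sqr_ge0.
  by rewrite integral_normM_exp_tail// -!EFinM mulrA.
move=> r0; rewrite BE T//.
(* At threshold 0 the region is the whole plane, of mass 1. *)
suff -> : (C * (normal_peak sigma ^+ 2 * s)%:E = 1)%E by rewrite mul1e.
have := T 0 (lexx 0); rewrite mul0r oppr0 expR0 mule1 => <-.
rewrite (_ : B 0 = setT) ?probability_setT//.
by apply/seteqP; split => // p _; rewrite /B/= addr_ge0// sqr_ge0.
Qed.

(** * Bit time: sign, sublevel sets and measurability *)

Lemma normc_sqr (R : realType) (z : R[i]) :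
  Normc.normc z ^+ 2 = (complex_to_pair z).1 ^+ 2 + (complex_to_pair z).2 ^+ 2.
Proof. by case: z => x y /=; rewrite sqr_sqrtr// addr_ge0// sqr_ge0. Qed.

Lemma log2_normc_ge0 (R : realType) (rho : R) (z : R[i]) : 0 < rho ->
  0 <= log2 (1 + rho * Normc.normc z ^+ 2).
Proof.
move=> rho0; rewrite divr_ge0 ?ln_ge0 ?ler1n//.
by rewrite lerDl mulr_ge0 ?sqr_ge0 ?ltW.
Qed.

Lemma bit_time_ge0 (R : realType) (rho : R) (z : R[i]) : 0 < rho ->
  (0 <= bit_time rho z)%E.
Proof. by move=> rho0; rewrite mule_ge0// inve_ge0 lee_fin log2_normc_ge0. Qed.

Lemma bit_time_le (R : realType) (rho a : R) (z : R[i]) : 0 < rho -> 0 < a ->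
  (bit_time rho z <= a%:E)%E =
  ((2 `^ (1 / a) - 1) / rho <= Normc.normc z ^+ 2).
Proof.
move=> rho0 a0.
have l0 := log2_normc_ge0 z rho0.
have x0 : 0 <= rho * Normc.normc z ^+ 2 by rewrite mulr_ge0 ?sqr_ge0 ?ltW.
have ln20 : 0 < ln 2 :> R by rewrite ln_gt0// ltr1n.
transitivity (a^-1 <= log2 (1 + rho * Normc.normc z ^+ 2)).
  (* At rate 0 the time is [+oo] and the left side fails; so does the right side, since a^-1 > 0. *)
  rewrite /bit_time mul1e inver; case: ifPn => [/eqP ->|lN0].
    by rewrite leNgt ltry leNgt invr_gt0 a0.
  by rewrite lee_fin -[RHS]lef_pV2 ?posrE ?invr_gt0 ?invrK// lt0r lN0.
rewrite ler_pdivlMr// -ln_powR mul1r.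
rewrite ler_ln ?posrE ?powR_gt0// ?ltr_pwDl//.
by rewrite ler_pdivrMr// lerBlDl mulrC.
Qed.

(** Immediate, since the measurable sets of [R[i]] are by construction the preimages under this
    map. *)
Lemma measurable_complex_to_pair (R : realType) :
  measurable_fun [set: R[i]] (@complex_to_pair R).
Proof. by move=> _ B mB; exists B. Qed.

Lemma measurable_normc_sqr (R : realType) :
  measurable_fun [set: R[i]] (fun z : R[i] => Normc.normc z ^+ 2).
Proof.
under eq_fun do rewrite normc_sqr.
apply: (measurableT_comp (f := fun p : R * R => p.1 ^+ 2 + p.2 ^+ 2)).
  by apply: measurable_funD; apply: measurable_funX.
exact: measurable_complex_to_pair.
Qed.

Lemma measurable_bit_time (R : realType) (rho : R) : 0 < rho ->
  measurable_fun [set: R[i]] (bit_time rho).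
Proof.
move=> rho0.
pose l z := log2 (1 + rho * Normc.normc z ^+ 2).
have ml : measurable_fun [set: R[i]] l.
  apply: measurable_funM => //; apply: measurableT_comp => //.
  apply: measurable_funD => //; apply: measurable_funM => //.
  exact: measurable_normc_sqr.
(* The inverse is written as a power: only powers are known to be measurable. *)
rewrite (_ : bit_time rho =
    fun z => if l z == 0 then +oo%E else (l z `^ (-1))%:E).
  apply: measurable_fun_ifT => //; first exact: measurable_fun_eqr.
  by apply/measurable_EFinP; apply: (measurableT_comp (measurable_powR _)).
by apply/funext => z; rewrite /bit_time mul1e inver powR_inv1// log2_normc_ge0.
Qed.

(** * The two bounds on the underflow probability *)

Theorem proposition4 (R : realType) (disp : measure_display)
    (T : measurableType disp) (P : probability T R)
    (rho y : R) (L D : nat) (h : 'I_D -> {RV P >-> R[i]}) :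
  0 < rho -> (1 <= L)%N -> (2 <= D)%N -> 0 < y ->
  (forall d (A : set R[i]), measurable A ->
     distribution P (h d) A = complex_normal (1 - error_variance rho L) A) ->
  mutually_independent h ->
  let G := noise_to_signal rho L in
  ((expR (- (D%:R * G * (2 `^ (D%:R / y) - 1))))%:E
     <= P [set t | \sum_(d < D) bit_time rho (h d t) <= y%:E]
     <= (expR (- (D%:R * G * (2 `^ (1 / y) - 1))))%:E)%E.
Proof.
move=> rho0 L1 D2 y0 hP hI; cbv zeta; set G := noise_to_signal rho L.
have D0 : 0 < D%:R :> R by rewrite ltr0n (leq_trans _ D2).
(* At least one pilot puts the error variance strictly below 1, so the Gaussian is nondegenerate. *)
have s0 : 0 < 1 - error_variance rho L.
  rewrite subr_gt0 /error_variance div1r invf_lt1 ?ltrDl ?mulr_gt0 ?ltr0n//.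
  by rewrite addr_gt0// mulr_gt0 ?ltr0n.
have mh d : measurable_fun setT (bit_time rho \o h d).
  by apply: measurableT_comp => //; exact: measurable_bit_time.
pose A a : set R[i] := [set z | bit_time rho z <= a%:E]%E.
have mA a : measurable (A a).
  rewrite -[A a]setTI.
  exact: emeasurable_fun_infty_c measurableT (measurable_bit_time rho0) _.
(* All times are at most [a]; the intersection runs over the full finite set so that
   [mutually_independent] applies to it. *)
pose E a := \bigcap_(d in [set` [set: 'I_D]%SET]) (h d @^-1` A a).
have mE a : measurable (E a).
  apply: fin_bigcap_measurable => [|d _]; first exact: finite_finset.
  by rewrite -[_ @^-1` _]setTI; exact: measurable_funP.
have PE a : 0 < a -> P (E a) = (expR (- (D%:R * G * (2 `^ (1 / a) - 1))))%:E.
  move=> a0; rewrite hI//.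
  have r0 : 0 <= (2 `^ (1 / a) - 1) / rho.
    apply: divr_ge0; last exact: ltW.
    rewrite subr_ge0 -[leLHS](powRr0 2).
    by rewrite ler_powR ?ler1n// divr_ge0 ?ltW.
  have PA d : P (h d @^-1` A a) = (expR (- (G * (2 `^ (1 / a) - 1))))%:E.
    transitivity (distribution P (h d) (A a)) => //.
    rewrite hP//.
    rewrite (_ : A a = [set z | (2 `^ (1 / a) - 1) / rho <= Normc.normc z ^+ 2]).
      rewrite complex_normal_tail//; congr (expR (- _))%:E.
      (* Dividing the threshold by the variance turns the factor 1 / rho into [G]. *)
      rewrite /G /noise_to_signal invfM.
      by field; rewrite !gt_eqF.
    by apply/seteqP; split => z; rewrite /A/= bit_time_le.
  under eq_bigr do rewrite PA.
  rewrite prodEFin prodr_const cardsT card_ord -expRM_natl.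
  by rewrite mulrN mulrA.
have mS : measurable [set t | (\sum_(d < D) bit_time rho (h d t))%R <= y%:E]%E.
  rewrite -[X in measurable X]setTI.
  apply: emeasurable_fun_infty_c => //.
  exact: (@emeasurable_sum _ _ _ _ _ _ (fun d => bit_time rho \o h d)).
apply/andP; split.
  (* Lower bound: D / y is 1 / a for a = y / D, and [D] times of at most y / D sum to at most
     [y]. *)
  rewrite -[D%:R / y]invf_div -div1r -PE ?divr_gt0//.
  apply: le_measure; rewrite ?inE//.
  move=> t Et /=.
  apply: (@le_trans _ _ (\sum_(d < D) (y / D%:R)%:E)%E).
    by apply: lee_sum => d _; apply: (Et d); rewrite /= inE.
  by rewrite sumEFin sumr_const card_ord -[_ *+ D]mulr_natr divfK// gt_eqF.
(* Upper bound: the other times being nonnegative, each one is at most the sum. *)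
rewrite -PE//; apply: le_measure; rewrite ?inE//.
move=> t /= St d _ /=; rewrite /A/=; apply: le_trans St.
rewrite (bigD1 d)//= leeDl// sume_ge0// => i _; exact: bit_time_ge0.
Qed.
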